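(* Let $A$ be an octonion division algebra over a field $F$ and let $B=\begin{pmatrix} a & b\\ c & d\end{pmatrix}\in M_2(A)$. If $b=0$, then $\sigma_L(B)=\{a,d\}$. If $b\neq 0$, then \[ \Sigma_L(B)=\left\{\left(\lambda,\begin{pmatrix} 1 \\ s \end{pmatrix} \cdot t\right) : t\in A^\times,\ s\in R(t^{-1}f(x)),\ \lambda=a+t((t^{-1} b)s)\right\}, \] where $f(x)=b x^2+(a-d)x-c\in A[x]$. In particular, when $b\in F^\times$, \[ \sigma_L(B)=\{\lambda\in A : b^{-1}(\lambda-a)\in LMR(f(x))\}. \]
   Context: An octonion algebra over $F$ is an $8$-dimensional Cayley--Dickson algebra over $F$, i.e. an algebra obtained from a quadratic separable extension $K$ of $F$ (with its non-trivial $F$-automorphism as involution) by applying twice the Cayley--Dickson doubling $A\mapsto A\{\gamma\}=A\oplus A\ell$, $\gamma\in F^\times$, with product $(q+r\ell)(s+t\ell)=qs+\gamma\overline{t}r+(tq+r\overline{s})\ell$ and involution $\overline{q+r\ell}=\overline{q}-r\ell$. An octonion division algebra is an octonion algebra that is a division algebra. $A^\times$ denotes the set of nonzero elements of $A$. For $B\in M_n(A)$, an element $\lambda\in A$ is a left eigenvalue of $B$ if $B\vec v=\lambda\vec v$ for some nonzero column vector $\vec v\in A^n$ (where $\lambda$ multiplies each entry from the left); $\sigma_L(B)$ is the set of left eigenvalues of $B$, and $\Sigma_L(B)=\{(\lambda,\vec v):\lambda\in A,\ \vec 0\neq\vec v\in A^n,\ B\vec v=\lambda\vec v\}$. For a vector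 $\vec v$ and $t\in A$, $\vec v\cdot t$ is the vector obtained by multiplying each entry by $t$ on the right. $A[x]=A\otimes_F F[x]$ with $x$ central, and for $f(x)=c_nx^n+\dots+c_0\in A[x]$ and $\lambda\in A$, $f(\lambda)=c_n(\lambda^n)+\dots+c_1\lambda+c_0$; $\lambda$ is a root if $f(\lambda)=0$. $R(f(x))$ denotes the set of roots of $f(x)$ in $A$. For $e\in A$, $e\cdot f(x)=(ec_n)x^n+\dots+(ec_1)x+ec_0$. $LMR(f(x))$ denotes the union of the sets $R(e\cdot f(x))$ as $e$ ranges over all nonzero elements of $A$. *)

(* Defs.v *)
From HB Require Import structures.
From mathcomp Require Import all_boot all_order all_algebra all_field.
From mathcomp Require Import finmap boolp classical_sets.

Set Implicit Arguments.
Unset Strict Implicit.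
Unset Printing Implicit Defensive.

Import GRing.Theory.

Local Open Scope classical_set_scope.
Local Open Scope ring_scope.

(* Unital, not necessarily associative, algebras: the product and the unit are
   those of a unital magma ([x * y]%g, [1]%g and [x ^+ n]%g), since the product
   of a MathComp ring is associative by definition. *)
HB.mixin Record isNonassocAlgebra (F : fieldType) A
    of GRing.Lmodule F A & UMagma A := {
  namulDl : forall x y z : A, ((x + y)%R * z)%g = (x * z)%g + (y * z)%g;
  namulDr : forall x y z : A, (x * (y + z)%R)%g = (x * y)%g + (x * z)%g;
  nascalerAl : forall (k : F) (x y : A), k *: (x * y)%g = ((k *: x) * y)%g;
  nascalerAr : forall (k : F) (x y : A), k *: (x * y)%g = (x * (k *: y))%g
}.

#[short(type="nonassocAlgType")]
HB.structure Definition NonassocAlgebra (F : fieldType) :=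
  {A of isNonassocAlgebra F A & GRing.Lmodule F A & UMagma A}.

Section CayleyDickson.
Variables (F : fieldType) (V : lmodType F).
Variables (mul : V -> V -> V) (conj : V -> V) (gamma : F).

(* The pair (q, r) stands for q + r l. *)
Definition cd_mul (x y : V * V) : V * V :=
  let: (q, r) := x in let: (s, t) := y in
  (mul q s + gamma *: mul (conj t) r, mul t q + mul r (conj s)).

Definition cd_conj (x : V * V) : V * V := (conj x.1, - x.2).
End CayleyDickson.

Section Octonion.
Variable F : fieldType.

Definition octonion_mul (K : fieldExtType F) (sigma : K -> K) (g1 g2 : F) :
    (K * K) * (K * K) -> (K * K) * (K * K) -> (K * K) * (K * K) :=
  cd_mul (cd_mul *%R sigma g1) (cd_conj sigma) g2.

Definition is_octonion_algebra (A : nonassocAlgType F) : Prop :=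
  exists (K : fieldExtType F) (sigma : 'AEnd(K)) (g1 g2 : F)
         (phi : {linear A -> ((K * K) * (K * K))%type}),
    [/\ \dim {:K} = 2%N, separable 1 {:K} & sigma != \1%AF] /\
    [/\ g1 != 0, g2 != 0, bijective phi &
        forall x y : A, phi (x * y)%g = octonion_mul sigma g1 g2 (phi x) (phi y)].

Definition is_division_algebra (A : nonassocAlgType F) : Prop :=
  (1%g : A) != 0 /\
  forall x : A, x != 0 ->
    bijective (fun y : A => (x * y)%g) /\ bijective (fun y : A => (y * x)%g).

End Octonion.

Section Algebra.
Variables (F : fieldType) (A : nonassocAlgType F).

(* The two-sided inverse of [x], and 0 if there is none. *)
Definition nainv (x : A) : A :=
  xget 0 [set y : A | (x * y)%g = 1%g /\ (y * x)%g = 1%g].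

Definition is_unit_scalar (b : A) : Prop :=
  exists2 beta : F, beta != 0 & b = beta *: 1%g.

Definition namulmx (m n : nat) (B : 'M[A]_(m, n)) (v : 'cV[A]_n) : 'cV[A]_m :=
  \col_i \sum_j (B i j * v j 0)%g.

Definition lscale (n : nat) (t : A) (v : 'cV[A]_n) : 'cV[A]_n :=
  map_mx (fun y : A => (t * y)%g) v.

Definition rscale (n : nat) (v : 'cV[A]_n) (t : A) : 'cV[A]_n :=
  map_mx (fun y : A => (y * t)%g) v.

Definition left_eigenvalues (n : nat) (B : 'M[A]_n) : set A :=
  [set lambda | exists2 v : 'cV[A]_n, v != 0 & namulmx B v = lscale lambda v].

Definition left_eigenpairs (n : nat) (B : 'M[A]_n) : set (A * 'cV[A]_n) :=
  [set p | p.2 != 0 /\ namulmx B p.2 = lscale p.1 p.2].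

Definition mx22 (a b c d : A) : 'M[A]_2 :=
  \matrix_(i < 2, j < 2) nth 0 (nth [::] [:: [:: a; b]; [:: c; d]] i) j.

Definition col2 (x y : A) : 'cV[A]_2 := \col_(i < 2) nth 0 [:: x; y] i.

(* A[x], as finitely supported families of coefficients: {poly A} is only
   available over associative rings. *)
Definition napoly := {fsfun nat -> A with 0}.

(* [:: c_0; c_1; ..; c_n] |-> c_n x^n + .. + c_1 x + c_0 *)
Definition napoly_of (s : seq A) : napoly :=
  [fsfun i in seq_fset tt (iota 0 (size s)) => nth 0 s i].

Definition napoly_eval (f : napoly) (lambda : A) : A :=
  \sum_(i <- finsupp f) (f i * lambda ^+ i)%g.

Definition napoly_lmul (e : A) (f : napoly) : napoly :=
  [fsfun i in finsupp f => (e * f i)%g].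

Definition napoly_roots (f : napoly) : set A :=
  [set lambda | napoly_eval f lambda = 0].

Definition napoly_LMR (f : napoly) : set A :=
  \bigcup_(e in [set e : A | e != 0]) napoly_roots (napoly_lmul e f).

End Algebra.

(* Main.v *)
(** Octonions satisfy the middle Moufang identity [(t (x y)) t = (t x) (y t)].
    If [t <> 0] is the first entry of an eigenvector, the second one is [s t]
    for some [s]. Writing each product [x (y t)] as [(t ((t^-1 x) y)) t], every
    term of the two eigenvalue equations becomes a value of the injective map
    [z |-> (t z) t] or of [z |-> z t]; cancelling these maps leaves the formula
    for [lambda] and the equation [(t^-1 f)(s) = 0]. *)

Require Import Defs.
From mathcomp Require Import all_boot all_order all_algebra all_field.
From mathcomp Require Import finmap boolp classical_sets.
From mathcomp Require Import ring.

Import GRing.Theory.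

Local Open Scope classical_set_scope.
Local Open Scope ring_scope.

(** * The middle Moufang identity for octonions *)

Lemma quadratic_aut_involutive (F : fieldType) (K : fieldExtType F)
    (sigma : 'AEnd(K)) (dimK : \dim {:K} = 2%N) : involutive sigma.
Proof.
move=> x; case: (eqVneq (sigma x) x) => [sx|sx_neq]; first by rewrite !sx.
set P := minPoly 1 x.
have size_P : (size P <= 3)%N.
  rewrite size_minPoly ltnS /adjoin_degree dimv1 divn1 prednK ?adim_gt0 //.
  by rewrite -dimK; apply/dimvS/subvf.
have rootP y : root P y -> root P (sigma y).
  have := minPolyOver 1 x; rewrite -/P => /polyOver1P [p ->] /eqP py.
  have sigma_fix : sigma \o in_alg K =1 in_alg K.
    by move=> k /=; rewrite linearZ /= rmorph1.
  rewrite -(eq_map_poly sigma_fix) map_poly_comp.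
  by rewrite /root horner_map py rmorph0.
have Px : root P x by rewrite root_minPoly.
have sigma_inj : injective sigma by apply: fmorph_inj.
have P_neq0 : P != 0 by rewrite monic_neq0 // monic_minPoly.
(* Otherwise [x], [sigma x] and [sigma (sigma x)] would be three distinct roots of [P], whose degree
   is at most 2. *)
apply/eqP; apply: contraTT size_P => ssx_neq; rewrite -ltnNge.
apply: (@max_poly_roots _ P [:: x; sigma x; sigma (sigma x)]) => //=.
  by rewrite Px !rootP.
by rewrite !inE negb_or (inj_eq sigma_inj) ![x == _]eq_sym sx_neq ssx_neq.
Qed.

(* The octonion product in coordinates over a commutative ring, with the
   coordinates [x'], [y'] of the conjugates under [sigma] as independent
   arguments: the Moufang identity then becomes a polynomial identity. *)
Definition octonion_coord_mul {R : comNzRingType} (e1 e2 : R)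
    (x x' y y' : (R * R) * (R * R)) : (R * R) * (R * R) :=
  let: ((x1, x2), (x3, x4)) := x in let: ((x1', x2'), (x3', x4')) := x' in
  let: ((y1, y2), (y3, y4)) := y in let: ((y1', y2'), (y3', y4')) := y' in
  ((x1 * y1 + e1 * (y2' * x2) + e2 * (y3' * x3 - e1 * (x4' * y4)),
    y2 * x1 + x2 * y1' + e2 * (x4 * y3' - y4 * x3')),
   (y3 * x1 + e1 * (x2' * y4) + (x3 * y1' - e1 * (y2' * x4)),
    x2 * y3 + y4 * x1' + (- (y2 * x3) + x4 * y1))).

(** The conjugate of a product is the product with primed and unprimed arguments exchanged, so each
    inner product is passed together with its exchanged copy. *)
Lemma octonion_coord_moufang (R : comNzRingType) (e1 e2 : R) t t' x x' y y' :
  let m := octonion_coord_mul e1 e2 in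
  m (m t t' (m x x' y y') (m x' x y' y)) (m t' t (m x' x y' y) (m x x' y y'))
    t t' =
  m (m t t' x x') (m t' t x' x) (m y y' t t') (m y' y t' t).
Proof.
case: t t' => [[t1 t2] [t3 t4]] [[t1' t2'] [t3' t4']].
case: x x' => [[x1 x2] [x3 x4]] [[x1' x2'] [x3' x4']].
case: y y' => [[y1 y2] [y3 y4]] [[y1' y2'] [y3' y4']] m.
by rewrite /m /octonion_coord_mul; congr ((_, _), (_, _)); ring.
Qed.

Definition map_coord {R : Type} (s : R -> R) (x : (R * R) * (R * R)) :=
  ((s x.1.1, s x.1.2), (s x.2.1, s x.2.2)).

Lemma map_coord_mul (R : comNzRingType) (s : {rmorphism R -> R}) (e1 e2 : R)
    x x' y y' :
  map_coord s (octonion_coord_mul e1 e2 x x' y y') =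
  octonion_coord_mul (s e1) (s e2)
    (map_coord s x) (map_coord s x') (map_coord s y) (map_coord s y').
Proof.
case: x x' => [[x1 x2] [x3 x4]] [[x1' x2'] [x3' x4']].
case: y y' => [[y1 y2] [y3 y4]] [[y1' y2'] [y3' y4']].
rewrite /map_coord /octonion_coord_mul; cbn [fst snd].
by congr ((_, _), (_, _)); rewrite !(rmorphD, rmorphN, rmorphM).
Qed.

Lemma octonion_mulE (F : fieldType) (K : fieldExtType F) (sigma : 'AEnd(K))
  (g1 g2 : F) x y : involutive sigma ->
  octonion_mul sigma g1 g2 x y =
  octonion_coord_mul g1%:A g2%:A x (map_coord sigma x) y (map_coord sigma y).
Proof.
move: x y => [[x1 x2] [x3 x4]] [[y1 y2] [y3 y4]] sigmaK.
have [e1 e1E] : {e : K | g1%:A = e} by exists g1%:A.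
have [e2 e2E] : {e : K | g2%:A = e} by exists g2%:A.
have e1Z z : g1 *: z = e1 * z by rewrite -e1E mulr_algl.
have e2Z z : g2 *: z = e2 * z by rewrite -e2E mulr_algl.
rewrite e1E e2E /octonion_mul /cd_mul /cd_conj /octonion_coord_mul /map_coord /=.
by congr ((_, _), (_, _)) => /=; rewrite ?e2Z ?e1Z ?sigmaK ?rmorphN ?mulNr ?mulrN.
Qed.

Lemma octonion_mul_moufang (F : fieldType) (K : fieldExtType F)
    (sigma : 'AEnd(K)) (g1 g2 : F) t x y : involutive sigma ->
  let m := octonion_mul sigma g1 g2 in m (m t (m x y)) t = m (m t x) (m y t).
Proof.
move=> sigmaK m.
have map_sigmaK : involutive (map_coord sigma).
  by move=> [[x1 x2] [x3 x4]]; rewrite /map_coord /= !sigmaK.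
have sigma_scalar k : sigma k%:A = k%:A by rewrite linearZ /= rmorph1.
(* [sigma] fixes scalars and is an involution, so conjugating a product exchanges each argument with
   its conjugate, as the coordinate identity requires. *)
have map_sigmaM u u' v v' :
    map_coord sigma (octonion_coord_mul g1%:A g2%:A u u' v v') =
    octonion_coord_mul g1%:A g2%:A (map_coord sigma u) (map_coord sigma u')
      (map_coord sigma v) (map_coord sigma v').
  by rewrite -{2}(sigma_scalar g1) -{2}(sigma_scalar g2); apply: map_coord_mul.
rewrite /m !octonion_mulE // !map_sigmaM !map_sigmaK.
exact: octonion_coord_moufang.
Qed.

Lemma octonion_moufang {F : fieldType} {A : nonassocAlgType F}
    (hO : is_octonion_algebra A) (t x y : A) :
  ((t * (x * y)) * t = (t * x) * (y * t))%g.
Proof.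
have [K [sigma [g1 [g2 [phi [[dimK _ _] [_ _ phi_bij phiM]]]]]]] := hO.
apply: (bij_inj phi_bij); rewrite !phiM.
exact/octonion_mul_moufang/quadratic_aut_involutive.
Qed.

(** * Cancellation and inverses in an octonion division algebra *)

Lemma namul0r {F : fieldType} {A : nonassocAlgType F} (x : A) : (0 * x)%g = 0.
Proof. by rewrite -(scale0r 0) -nascalerAl !scale0r. Qed.

Lemma namulr0 {F : fieldType} {A : nonassocAlgType F} (x : A) : (x * 0)%g = 0.
Proof. by rewrite -(scale0r 0) -nascalerAr !scale0r. Qed.

Lemma namulNr {F : fieldType} {A : nonassocAlgType F} (x y : A) :
  (- x * y)%g = - (x * y)%g.
Proof. by rewrite -scaleN1r -nascalerAl scaleN1r. Qed.

Lemma namulrN {F : fieldType} {A : nonassocAlgType F} (x y : A) :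
  (x * - y)%g = - (x * y)%g.
Proof. by rewrite -scaleN1r -nascalerAr scaleN1r. Qed.

Lemma division_mulI {F : fieldType} {A : nonassocAlgType F}
    (hD : is_division_algebra A) (t : A) :
  t != 0 -> injective (fun x : A => (t * x)%g).
Proof. by move=> /hD.2 [/bij_inj]. Qed.

Lemma division_mulIr {F : fieldType} {A : nonassocAlgType F}
    (hD : is_division_algebra A) (t : A) :
  t != 0 -> injective (fun x : A => (x * t)%g).
Proof. by move=> /hD.2 [_ /bij_inj]. Qed.

Lemma division_mul_eq0 {F : fieldType} {A : nonassocAlgType F}
    (hD : is_division_algebra A) (x y : A) :
  ((x * y)%g == 0) = (x == 0) || (y == 0).
Proof.
have [->|x_neq0] := eqVneq x 0; first by rewrite namul0r eqxx.
apply/eqP/eqP => [xy0|->]; last by rewrite namulr0.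
by apply: (division_mulI hD _ x_neq0); rewrite namulr0.
Qed.

Lemma nainv_unique {F : fieldType} {A : nonassocAlgType F}
    (hD : is_division_algebra A) (t u : A) :
  (t * u)%g = 1%g -> (u * t)%g = 1%g -> nainv t = u.
Proof.
(* The witness [u] excludes the default value 0; the inverse chosen instead equals [u] after
   cancelling [t]. *)
move=> tu ut; rewrite /nainv; case: xgetP => [y _ [ty _]|/(_ u)]; last by case.
have t_neq0 : t != 0.
  by apply: contraNneq hD.1 => t0; rewrite -tu t0 namul0r.
by apply: (division_mulI hD _ t_neq0); rewrite /= ty tu.
Qed.

(** The solution [u] of [t u = 1] is also a left inverse: [(t (u t)) t = (t u) (t t) = (t 1) t], and
    [t] cancels on both sides. *)
Lemma nainv_correct {F : fieldType} {A : nonassocAlgType F}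
    (hO : is_octonion_algebra A) (hD : is_division_algebra A) (t : A) :
  t != 0 -> (t * nainv t)%g = 1%g /\ (nainv t * t)%g = 1%g.
Proof.
move=> t_neq0; have [[g _ gK] _] := hD.2 t t_neq0.
have tu : (t * g 1%g)%g = 1%g := gK 1%g.
suff ut : (g 1%g * t)%g = 1%g by rewrite (nainv_unique hD _ _ tu ut).
apply: (division_mulI hD _ t_neq0); apply: (division_mulIr hD _ t_neq0).
by rewrite /= (octonion_moufang hO) tu mul1g mulg1.
Qed.

(** With [u] the inverse of [t], the Moufang identity gives [(t (u x)) t = (t u) (x t) = x t];
    cancel [t] on the right. *)
Lemma mul_nainvK {F : fieldType} {A : nonassocAlgType F}
    (hO : is_octonion_algebra A) (hD : is_division_algebra A) (t x : A) :
  t != 0 -> (t * (nainv t * x))%g = x.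
Proof.
move=> t_neq0; apply: (division_mulIr hD _ t_neq0).
have [tu _] := nainv_correct hO hD _ t_neq0.
by rewrite /= (octonion_moufang hO) tu mul1g.
Qed.

Lemma nainv_neq0 {F : fieldType} {A : nonassocAlgType F}
    (hO : is_octonion_algebra A) (hD : is_division_algebra A) (t : A) :
  t != 0 -> nainv t != 0.
Proof.
move=> /(nainv_correct hO hD) [tu _].
by apply: contraNneq hD.1 => u0; rewrite -tu u0 namulr0.
Qed.

Lemma nainvK {F : fieldType} {A : nonassocAlgType F}
    (hO : is_octonion_algebra A) (hD : is_division_algebra A) (t : A) :
  t != 0 -> nainv (nainv t) = t.
Proof. by move=> /(nainv_correct hO hD) [tu ut]; apply: nainv_unique. Qed.

(** Write [x = t z]. Then [((t z) t) t = (t (z t)) t = (t z) (t t)], by flexibility (Moufang with a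
    factor 1) and then by Moufang. *)
Lemma octonion_right_alternative {F : fieldType} {A : nonassocAlgType F}
    (hO : is_octonion_algebra A) (hD : is_division_algebra A) (x t : A) :
  ((x * t) * t = x * (t * t))%g.
Proof.
have [->|t_neq0] := eqVneq t 0; first by rewrite !namulr0.
rewrite -(mul_nainvK hO hD _ x t_neq0); set z := (nainv t * x)%g.
have flexible u : ((t * u) * t = t * (u * t))%g.
  by rewrite -[u in LHS]mul1g (octonion_moufang hO) mulg1.
by rewrite flexible -(octonion_moufang hO) flexible.
Qed.

(** * Evaluation of polynomials with octonion coefficients *)

Lemma napoly_evalE {F : fieldType} {A : nonassocAlgType F} (g : napoly A)
    (n : nat) (s : A) : (forall i, (n <= i)%N -> g i = 0) ->
  napoly_eval g s = \sum_(i < n) (g i * s ^+ i)%g.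
Proof.
move=> g0; rewrite -(big_mkord xpredT (fun i => (g i * s ^+ i)%g)) /napoly_eval.
rewrite /index_iota subn0 (perm_big [seq i <- iota 0 n | i \in finsupp g]).
  rewrite big_filter big_mkcond; apply: eq_bigr => i _.
  by case: finsuppP => //; rewrite namul0r.
apply: uniq_perm; rewrite ?fset_uniq ?filter_uniq ?iota_uniq // => i.
rewrite mem_filter mem_iota add0n /= mem_finsupp.
have [//|gi_neq0] := eqVneq (g i) 0.
by rewrite ltnNge; apply/esym; apply: contraNN gi_neq0 => /g0 ->.
Qed.

Lemma napoly_lmulE {F : fieldType} {A : nonassocAlgType F} (e : A)
    (g : napoly A) i : napoly_lmul e g i = (e * g i)%g.
Proof. by rewrite fsfunE; case: finsuppP => //; rewrite namulr0. Qed.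

Lemma napoly_ofE {F : fieldType} {A : nonassocAlgType F} (r : seq A) i :
  napoly_of r i = nth 0 r i.
Proof.
rewrite fsfunE seq_fsetE mem_iota add0n /=.
by case: ltnP => // /(nth_default 0) ->.
Qed.

Lemma napoly_lmul_roots2 {F : fieldType} {A : nonassocAlgType F}
    (e c0 c1 c2 s : A) :
  napoly_roots (napoly_lmul e (napoly_of [:: c0; c1; c2])) s <->
  ((e * c0)%g + (e * c1 * s)%g + (e * c2 * (s * s))%g = 0).
Proof.
rewrite /napoly_roots /= (napoly_evalE _ 3); last first.
  by move=> i ?; rewrite napoly_lmulE napoly_ofE nth_default ?namulr0.
rewrite !big_ord_recr big_ord0 /= add0r !napoly_lmulE !napoly_ofE /=.
by rewrite expg0 mulg1.
Qed.

(** * The eigenvector equations of a two-by-two matrix *)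

Lemma col2_surj {F : fieldType} {A : nonassocAlgType F} (v : 'cV[A]_2) :
  exists x y, v = col2 x y.
Proof.
exists (v 0 0), (v 1 0); apply/matrixP => i j; rewrite !mxE ord1.
by case: i => [[|[|i]] hi] //=; congr (v _ _); apply: val_inj.
Qed.

Lemma col2_neq0 {F : fieldType} {A : nonassocAlgType F} (x y : A) :
  (col2 x y != 0) = (x != 0) || (y != 0).
Proof.
rewrite -negb_and; congr (~~ _); apply/eqP/andP => [/matrixP xy|[/eqP-> /eqP->]].
  by have := xy 0 0; have := xy 1 0; rewrite !mxE /= => -> ->.
by apply/matrixP => i j; rewrite !mxE; case: i => [[|[|i]] hi].
Qed.

Lemma rscale_col2 {F : fieldType} {A : nonassocAlgType F} (x y t : A) :
  rscale (col2 x y) t = col2 (x * t)%g (y * t)%g.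
Proof. by apply/matrixP => i j; rewrite !mxE; case: i => [[|[|i]] hi]. Qed.

Lemma left_eigen_col2 {F : fieldType} {A : nonassocAlgType F}
    (a b c d lambda x y : A) :
  namulmx (mx22 a b c d) (col2 x y) = lscale lambda (col2 x y) <->
  (a * x)%g + (b * y)%g = (lambda * x)%g /\
  (c * x)%g + (d * y)%g = (lambda * y)%g.
Proof.
split=> [/matrixP eq|[eq0 eq1]].
  have := eq 0 0; have := eq 1 0.
  by rewrite !mxE !big_ord_recr !big_ord0 !mxE /= !add0r.
apply/matrixP => i j; rewrite !mxE !big_ord_recr !big_ord0 !mxE /= !add0r.
by case: i => [[|[|i]] hi].
Qed.

Lemma left_eigen_rscale {F : fieldType} {A : nonassocAlgType F}
    (hO : is_octonion_algebra A) (hD : is_division_algebra A)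
    (a b c d lambda t s : A) : t != 0 ->
  namulmx (mx22 a b c d) (rscale (col2 1%g s) t) =
    lscale lambda (rscale (col2 1%g s) t) <->
  lambda = a + (t * ((nainv t * b) * s))%g /\
  napoly_roots (napoly_lmul (nainv t) (napoly_of [:: - c; a - d; b])) s.
Proof.
move=> t_neq0; set w := nainv t.
have tI := division_mulI hD _ t_neq0.
have It := division_mulIr hD _ t_neq0.
have moufang := octonion_moufang hO.
have twK x : (t * (w * x))%g = x by apply: mul_nainvK.
have sandwich x y : (x * (y * t))%g = (t * ((w * x) * y) * t)%g.
  by rewrite moufang twK.
rewrite rscale_col2 left_eigen_col2 mul1g napoly_lmul_roots2.
have -> : ((a * t)%g + (b * (s * t))%g = (lambda * t)%g) <->
          lambda = a + (t * ((w * b) * s))%g.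
  rewrite sandwich -namulDl; split=> [/It -> //|-> //].
(* With the value of [lambda] from the first row substituted, the second row has to become the root
   condition. *)
suff eq2 : (c * t)%g + (d * (s * t))%g =
      ((a + (t * ((w * b) * s))%g) * (s * t))%g <->
    (w * - c)%g + (w * (a - d) * s)%g + (w * b * (s * s))%g = 0.
  by split=> [[->] /eq2|[-> /eq2]].
(* Source of the quadratic term: [(t ((w b) s)) (s t) = (t (((w b) s) s)) t] by Moufang, and right
   alternativity turns [((w b) s) s] into [(w b) (s s)]. *)
rewrite namulDl -[X in _ = _ + X]moufang (octonion_right_alternative hO hD).
(* Using [c = t (w c)] for the constant term, both sides take the form [(t z) t], which can be
   cancelled. *)
rewrite !sandwich -{1}[c]twK -!namulDl -!namulDr.
rewrite !namulrN (namulDr w) namulrN (namulDl _ _ s) namulNr.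
set p := (w * c)%g; set q := (w * d * s)%g; set r := (w * a * s)%g.
set u := (w * b * (s * s))%g.
have -> : - p + (r - q) + u = (r + u) - (p + q).
  by rewrite (addrA (- p)) [LHS]addrAC (addrC (- p) r) opprD [RHS]addrACA [RHS]addrA.
by split=> [/It /tI ->|/subr0_eq ->]; rewrite ?subrr.
Qed.

(** * Eigenvalues and eigenpairs according to the entry [b] *)

Theorem theorem3p5 (F : fieldType) (A : nonassocAlgType F)
    (hO : is_octonion_algebra A) (hD : is_division_algebra A) (a b c d : A) :
  let B := mx22 a b c d in
  let f := napoly_of [:: - c; a - d; b] in
  (b = 0 -> left_eigenvalues B = [set a; d]) /\
  (b != 0 ->
    left_eigenpairs B =
      [set p : A * 'cV[A]_2 | exists t s : A,
        [/\ t != 0,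
            napoly_roots (napoly_lmul (nainv t) f) s &
            p = (a + (t * ((nainv t * b) * s))%g, rscale (col2 1%g s) t)]]) /\
  (is_unit_scalar b ->
    left_eigenvalues B =
      [set lambda : A | napoly_LMR f (nainv b * (lambda - a))%g]).
Proof.
move=> B f.
have eigenpairs_eq : b != 0 -> left_eigenpairs B =
      [set p : A * 'cV[A]_2 | exists t s : A,
        [/\ t != 0,
            napoly_roots (napoly_lmul (nainv t) f) s &
            p = (a + (t * ((nainv t * b) * s))%g, rscale (col2 1%g s) t)]].
  move=> b_neq0; apply/seteqP; split=> [[lambda v]|_ [t [s [t_neq0 root_s ->]]]].
    move=> [/= v_neq0 eigen]; have [t [y vE]] := col2_surj v.
    move: v_neq0 eigen; rewrite {}vE => v_neq0 eigen.
    (* If the first entry vanished, the first row would read [b y = 0] and force [y = 0] too. *)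
    have t_neq0 : t != 0.
      move: eigen v_neq0 => /left_eigen_col2 [eq1 _]; rewrite col2_neq0.
      case: eqP => //= t0; move: eq1; rewrite t0 !namulr0 add0r => /eqP.
      by rewrite division_mul_eq0 // (negbTE b_neq0) => /= ->.
    (* Right division by [t]: [g y] is the [s] with [s t = y]. *)
    have [_ [g _ gK]] := hD.2 t t_neq0.
    have colE : col2 t y = rscale (col2 1%g (g y)) t.
      by rewrite rscale_col2 mul1g gK.
    move: eigen; rewrite colE => /left_eigen_rscale -/(_ hO hD t_neq0) [-> root_s].
    by exists t, (g y).
  split=> /=; first by rewrite rscale_col2 mul1g col2_neq0 t_neq0.
  exact/left_eigen_rscale.
split; last split=> //.
  move=> b0; apply/seteqP; split=> [lambda [v]|lambda].
    have [x [y ->]] := col2_surj v.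
    rewrite col2_neq0 => xy_neq0 /left_eigen_col2; rewrite b0 namul0r addr0.
    (* The first row [a x = lambda x] gives [lambda = a] unless [x = 0]; then [y] is nonzero and the
       second row gives [lambda = d]. *)
    have [x0|x_neq0] := eqVneq x 0; last first.
      by move=> [/(division_mulIr hD _ x_neq0) -> _]; left.
    move: xy_neq0; rewrite x0 eqxx /= => y_neq0 [_].
    by rewrite namulr0 add0r => /(division_mulIr hD _ y_neq0) ->; right.
  have eigen_d : left_eigenvalues B d.
    exists (col2 0 1%g); first by rewrite col2_neq0 hD.1 orbT.
    by apply/left_eigen_col2; rewrite b0 !namulr0 namul0r !add0r.
  (* For [a] different from [d], the vector with entries 1 and [y], where [(a - d) y = c], is an
     eigenvector for [a]. *)
  case=> [->|-> //]; have [-> //|a_neq_d] := eqVneq a d.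
  have ad_neq0 : a - d != 0 by rewrite subr_eq0.
  have [[g _ gK] _] := hD.2 _ ad_neq0.
  exists (col2 1%g (g c)); first by rewrite col2_neq0 hD.1.
  apply/left_eigen_col2; rewrite b0 namul0r addr0; split=> //.
  by rewrite mulg1 -{1}(gK c) -namulDl subrK.
move=> [beta beta_neq0 bE].
have b_neq0 : b != 0 by rewrite bE scaler_eq0 negb_or beta_neq0 hD.1.
(* A scalar [b] can be moved out of the product, so [lambda = a + b s] whatever [t] is, and [s] is
   recovered from [lambda]. *)
have central t s : t != 0 -> (t * ((nainv t * b) * s))%g = (b * s)%g.
  move=> t_neq0; rewrite bE -nascalerAr mulg1 -!nascalerAl mul1g -nascalerAr.
  by rewrite mul_nainvK.
apply/seteqP; split=> lambda /=.
  move=> [v v_neq0 eigen].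
  have : left_eigenpairs B (lambda, v) by [].
  rewrite eigenpairs_eq // => -[t [s [t_neq0 root_s [-> _]]]].
  exists (nainv t); first exact: nainv_neq0.
  rewrite central // addrC addKr.
  suff -> : (nainv b * (b * s))%g = s by [].
  by apply: (division_mulI hD _ b_neq0); rewrite /= mul_nainvK.
move=> [e /= e_neq0 root_s]; set s := (nainv b * (lambda - a))%g in root_s.
(* The multiplier [e] corresponds to the eigenvector scaled by [t = nainv e], since then
   [nainv t = e]. *)
have t_neq0 : nainv e != 0 by apply: nainv_neq0.
suff [] : left_eigenpairs B (lambda, rscale (col2 1%g s) (nainv e)).
  by exists (rscale (col2 1%g s) (nainv e)).
rewrite eigenpairs_eq //; exists (nainv e), s; split=> //; first by rewrite nainvK.
by rewrite central // mul_nainvK // addrC subrK.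
Qed.
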